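(* Assume there is a constant $c>0$ with $\lambda^*\in[c,1]$, and let $\delta\in(0,1]$. Then, for suitable parameters $\epsilon,T$ (depending on $\delta,\sigma,c,m$), the core algorithm (described in the context) computes a primal solution $x^{(T)}\in\mathcal{X}$ and a dual solution $z^{(T)}=\frac1T\sum_{t=1}^T\frac{y^{(t)}}{\|y^{(t)}\|_1}\in\Delta_m$ satisfying \[\|x^{(T)}\|_\infty\le(1+\delta)\sigma\lambda^*,\qquad\min_{x\in\mathcal{X}}\langle z^{(T)},x\rangle\ge(1-\delta)\frac{\lambda^*}{\sigma},\] and $\max_{r\in S}x^{(T)}_r\le\mu+\delta\max\{\lambda^*,\mu\}$ for all $S\subseteq\mathcal{R}$, $\mu\ge0$ such that local weak duality holds w.r.t. $S$ and $\mu$, using $\mathcal{O}\!\left(\frac{n+m}{\delta^2}\log m\right)$ oracle calls.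
   Context: Resource sharing problem: finite sets $\mathcal{C}$ (customers) and $\mathcal{R}$ (resources), $n=|\mathcal{C}|$, $m=|\mathcal{R}|$; for each $C$ a nonempty closed convex $X_C\subseteq\mathbb{R}^{\mathcal{R}}_{\ge0}$; $\mathcal{X}=\sum_C X_C$ (Minkowski sum); $opt_C(y)=\min_{x\in X_C}\langle y,x\rangle$; a constant $\sigma\ge1$ (treated as a constant in $\mathcal{O}$-notation) and oracles $f_C:\mathbb{R}^m_{\ge0}\to X_C$ with $\langle y,f_C(y)\rangle\le\sigma\,opt_C(y)$, an evaluation of some $f_C$ being an oracle call; $\lambda^*=\min_{x\in\mathcal{X}}\|x\|_\infty$; $\Delta_m=\{p\in[0,1]^m:\|p\|_1=1\}$. Local weak duality w.r.t. $S\subseteq\mathcal{R}$ and $\mu\ge0$: for every family $(y^{(C)})_{C}$ in $\mathbb{R}^m_{\ge0}$, $\sum_C\sum_{r\in S}y^{(C)}_rf_C(y^{(C)})_r\le\mu\sum_{r\in S}\max_Cy^{(C)}_r$. Core algorithm with parameters $\epsilon>0$, $T\in\mathbb{N}$: initialize $y=\mathbb{1}\in\mathbb{R}^m$. For phases $t=1,\dots,T$: for each customer $C$ (in a fixed order) set $\alpha=0$, $s^{(t)}_C=0$ and, while $\alpha<1$: $b\gets f_C(y)$; $\xi\gets\min\{1-\alpha,1/\|b\|_\infty\}$; $y_r\gets y_r\exp(\epsilon\xi b_r)$ for all $r$; $s^{(t)}_C\gets s^{(t)}_C+\xi b$; $\alpha\gets\alpha+\xi$. Then $s^{(t)}=\sum_Cs^{(t)}_C$.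 Output $x^{(T)}=\frac1T\sum_{t=1}^Ts^{(t)}$. $y^{(t)}$ is the price vector after phase $t$.
   Formalization: The oracle-call bound is stated with log(max{m,2}) in place of log m: the two agree for m ≥ 2, while for m = 1 the literal bound would be 0 although each phase needs at least one oracle call. *)

(* Defs.v *)
From HB Require Import structures.
From mathcomp Require Import all_boot all_order all_algebra.
From mathcomp Require Import all_classical all_reals all_analysis.

Set Implicit Arguments.
Unset Strict Implicit.
Unset Printing Implicit Defensive.

Import Order.TTheory GRing.Theory Num.Theory.
Import numFieldNormedType.Exports.

Local Open Scope classical_set_scope.
Local Open Scope ring_scope.

(* The resources are the elements of 'I_m, so that R^m is 'rV[R]_m.  The
   library norm `|x| on 'rV[R]_m is the maximum norm. *)

Definition nneg (R : realType) (m : nat) (x : 'rV[R]_m) : Prop :=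
  forall r, 0 <= x 0 r.

Definition dot (R : realType) (m : nat) (y x : 'rV[R]_m) : R :=
  \sum_(r < m) y 0 r * x 0 r.

Definition l1norm (R : realType) (m : nat) (x : 'rV[R]_m) : R :=
  \sum_(r < m) `|x 0 r|.

Definition simplex (R : realType) (m : nat) : set 'rV[R]_m :=
  [set p : 'rV[R]_m | (forall r, 0 <= p 0 r <= 1) /\ l1norm p = 1].

Definition minkowski_sum (R : realType) (m : nat) (C : finType)
    (X : C -> set 'rV[R]_m) : set 'rV[R]_m :=
  [set \sum_c x c | x in [set x : C -> 'rV[R]_m | forall c, X c (x c)]].

(* The minima of the problem are written as infima; A is always nonempty and
   the values are nonnegative, so the infimum is the minimum whenever the
   latter exists. *)
Definition opt (R : realType) (m : nat) (A : set 'rV[R]_m) (y : 'rV[R]_m) : R :=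
  inf [set dot y x | x in A].

Definition lambda_star (R : realType) (m : nat) (C : finType)
    (X : C -> set 'rV[R]_m) : R :=
  inf [set `|x| | x in minkowski_sum X].

(* Only the values of f on nonnegative vectors are constrained. *)
Definition is_oracle (R : realType) (m : nat) (sigma : R)
    (A : set 'rV[R]_m) (f : 'rV[R]_m -> 'rV[R]_m) : Prop :=
  forall y, nneg y -> A (f y) /\ dot y (f y) <= sigma * opt A y.

(* The maximum over the customers starts at 0, which is harmless because the
   prices are nonnegative. *)
Definition local_weak_duality (R : realType) (m : nat) (C : finType)
    (f : C -> 'rV[R]_m -> 'rV[R]_m) (S : {set 'I_m}) (mu : R) : Prop :=
  forall y : C -> 'rV[R]_m, (forall c, nneg (y c)) ->
    \sum_c \sum_(r in S) y c 0 r * f c (y c) 0 r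
      <= mu * \sum_(r in S) \big[Num.max/0]_c y c 0 r.

(* xi = min {1 - alpha, 1 / ||b||}, with 1 / 0 = +oo (whereas 0^-1 = 0 in the
   library). *)
Definition step_size (R : realType) (m : nat) (alpha : R) (b : 'rV[R]_m) : R :=
  if b == 0 then 1 - alpha else Num.min (1 - alpha) `|b|^-1.

Definition price_update (R : realType) (m : nat) (eps xi : R)
    (b y : 'rV[R]_m) : 'rV[R]_m :=
  \row_r (y 0 r * expR (eps * xi * b 0 r)).

(* customer_run f eps alpha y s k y' s': the while loop of a customer with
   oracle f, entered with the values alpha, y, s, terminates after exactly k
   iterations (i.e. k oracle calls) with prices y' and accumulated vector s'. *)
Inductive customer_run (R : realType) (m : nat) (f : 'rV[R]_m -> 'rV[R]_m)
    (eps : R) :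
    R -> 'rV[R]_m -> 'rV[R]_m -> nat -> 'rV[R]_m -> 'rV[R]_m -> Prop :=
| customer_stop alpha y s :
    1 <= alpha -> customer_run f eps alpha y s 0 y s
| customer_step (alpha : R) (y s : 'rV[R]_m) k y' s' :
    alpha < 1 ->
    (let b := f y in
     let xi := step_size alpha b in
     customer_run f eps (alpha + xi) (price_update eps xi b y) (s + xi *: b)
       k y' s') ->
    customer_run f eps alpha y s k.+1 y' s'.

(* phase_run f eps cs y k y' s: treating the customers of cs in this order,
   starting from prices y, uses k oracle calls in total and yields prices y'
   and s = \sum_(c <- cs) s_c. *)
Inductive phase_run (R : realType) (m : nat) (C : finType)
    (f : C -> 'rV[R]_m -> 'rV[R]_m) (eps : R) :
    seq C -> 'rV[R]_m -> nat -> 'rV[R]_m -> 'rV[R]_m -> Prop :=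
| phase_nil y : phase_run f eps [::] y 0 y 0
| phase_cons c cs y k1 y1 s1 k2 y2 s2 :
    customer_run (f c) eps 0 y 0 k1 y1 s1 ->
    phase_run f eps cs y1 k2 y2 s2 ->
    phase_run f eps (c :: cs) y (k1 + k2)%N y2 (s1 + s2).

(* y t is the price vector after phase t, with y 0 the initial one; s t and
   k t are the vector and the number of oracle calls of phase t >= 1 (s 0 and
   k 0 are irrelevant). *)
Definition core_run (R : realType) (m : nat) (C : finType)
    (f : C -> 'rV[R]_m -> 'rV[R]_m) (eps : R) (T : nat) (cs : seq C)
    (y s : nat -> 'rV[R]_m) (k : nat -> nat) : Prop :=
  y 0%N = const_mx 1 /\
  forall t, (1 <= t <= T)%N -> phase_run f eps cs (y t.-1) (k t) (y t) (s t).

Definition primal_output (R : realType) (m : nat) (T : nat)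
    (s : nat -> 'rV[R]_m) : 'rV[R]_m :=
  T%:R^-1 *: \sum_(1 <= t < T.+1) s t.

Definition dual_output (R : realType) (m : nat) (T : nat)
    (y : nat -> 'rV[R]_m) : 'rV[R]_m :=
  T%:R^-1 *: \sum_(1 <= t < T.+1) (l1norm (y t))^-1 *: y t.

(* Main.v *)
(* The sum Phi of the prices serves as a potential.  As xi * b_r <= 1, the
   chord bound exp (eps * x) <= 1 + eta * x on [0, 1], with
   eta = exp eps - 1, shows that one phase increases Phi by at most
   eta * sigma * opt (y_t), because prices only grow during the phase.  Hence
   Phi_t * (1 - eta * sigma * o_t) <= Phi_(t-1) with
   o_t = opt (y_t) / Phi_t <= lambda_star, and taking logarithms of
   exp (eps * T * x_r) = y_T r <= Phi_T bounds every load x_r by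
   ln m / (eps * T) plus (1 + delta / 2) * sigma times the average of the o_t.
   That average is at most lambda_star, which gives the primal bound, and at
   most opt (z), which gives the dual bound since lambda_star <= |x|.  The same
   argument for the sum of the prices over S, with mu instead of sigma * o_t,
   gives the local bound (for mu >= (1 + delta) * sigma * lambda_star it
   follows from the primal one).  Every oracle call that is not the last one
   of a customer in a phase increases the sum of all loads by at least 1, which
   bounds the number of calls; each loop terminates since it multiplies some
   price by exp eps at each such call while Phi stays bounded. *)

Require Import Defs.
From HB Require Import structures.
From mathcomp Require Import all_boot all_order all_algebra.
From mathcomp Require Import all_classical all_reals all_analysis.
From mathcomp Require Import ring lra.

Set Implicit Arguments.
Unset Strict Implicit.
Unset Printing Implicit Defensive.

Import Order.TTheory GRing.Theory Num.Theory.
Import numFieldNormedType.Exports.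

Local Open Scope classical_set_scope.
Local Open Scope ring_scope.

(** * Exponential estimates and growth of the potential *)

Lemma expR_le_chord (R : realType) (e x : R) : 0 <= x <= 1 ->
  expR (e * x) <= 1 + (expR e - 1) * x.
Proof.
move=> /andP[x0 x1].
have := @convex_expR R (Itv01 x0 x1) e 0.
rewrite !convRE/= mulr0 addr0 expR0 mulr1 (mulrC x e) => /le_trans; apply.
rewrite /unstable.onem; lra.
Qed.

Lemma expRB1_ge0 (R : realType) (e : R) : 0 <= e -> 0 <= expR e - 1.
Proof. by move=> e0; have := expR_ge1Dx e; lra. Qed.

Lemma expRB1_le (R : realType) (e : R) : e < 1 -> expR e - 1 <= e / (1 - e).
Proof.
move=> e1; have d0 : 0 < 1 - e by lra.
have := expR_ge1Dx (- e); rewrite expRN => h.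
have : expR e <= (1 - e)^-1.
  by rewrite -[expR e]invrK lef_pV2 // posrE invr_gt0 expR_gt0.
suff -> : e / (1 - e) = (1 - e)^-1 - 1 by lra.
by field; rewrite gt_eqF.
Qed.

(** Since [1 / (1 - a) = 1 + a / (1 - a)], replacing the last denominator by the smaller [1 - th]
    leaves a bound of the form [1 + u <= expR u]. *)
Lemma onem_inv_le_expR (R : realType) (a th : R) : 0 <= a <= th -> th < 1 ->
  (1 - a)^-1 <= expR (a / (1 - th)).
Proof.
move=> /andP[a0 ath] th1; apply: le_trans (expR_ge1Dx _).
have -> : (1 - a)^-1 = 1 + a / (1 - a) by field; rewrite gt_eqF //; lra.
by rewrite lerD2l ler_wpM2l // lef_pV2 ?posrE; lra.
Qed.

(** A discrete Gronwall inequality in implicit form: the increment is measured against the new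
    value, so step [t] costs a factor [1 / (1 - a t)], and [th] keeps all these factors under
    control. *)
Lemma potential_growth (R : realType) (Phi a : nat -> R) (th : R) (T : nat) :
  th < 1 -> 0 <= Phi 0%N ->
  (forall t, (t < T)%N -> 0 <= a t.+1 <= th) ->
  (forall t, (t < T)%N -> Phi t.+1 - Phi t <= a t.+1 * Phi t.+1) ->
  Phi T <= Phi 0%N * expR ((\sum_(1 <= t < T.+1) a t) / (1 - th)).
Proof.
move=> th1 Phi0; elim: T => [|T IH] ha hP.
  by rewrite big_geq // mul0r expR0 mulr1.
rewrite big_nat_recr //= mulrDl expRD mulrA.
have h := hP T (ltnSn T); have /andP[a0 ath] := ha T (ltnSn T).
have d0 : 0 < 1 - a T.+1 by lra.
have : Phi T.+1 <= Phi T * (1 - a T.+1)^-1 by rewrite ler_pdivlMr //; lra.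
move/le_trans; apply; apply: (le_trans (ler_wpM2r _ (IH _ _))).
- by rewrite invr_ge0 ltW.
- by move=> t tT; apply: ha; rewrite ltnW.
- by move=> t tT; apply: hP; rewrite ltnW.
apply: ler_wpM2l; last by apply: onem_inv_le_expR; rewrite ?a0.
by rewrite mulr_ge0 // expR_ge0.
Qed.

(** * Maximum norm and convex combinations *)

Lemma mx_normr_leP (R : realType) (m : nat) (x : 'rV[R]_m) (B : R) : 0 <= B ->
  reflect (forall r, `|x 0 r| <= B) (`|x| <= B).
Proof.
move=> B0; rewrite [`|x|]mx_normrE; apply: (iffP (bigmax_leP _ _ _ _)).
  by move=> [_ h] r; apply: (h (0, r)).
by move=> h; split => // -[i r] _ /=; rewrite ord1.
Qed.

Lemma ler_mx_normr (R : realType) (m : nat) (x : 'rV[R]_m) r : `|x 0 r| <= `|x|.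
Proof. exact: (elimT (mx_normr_leP x (normr_ge0 x))). Qed.

Lemma norm_le_sum_nneg (R : realType) (m : nat) (x : 'rV[R]_m) :
  nneg x -> `|x| <= \sum_r x 0 r.
Proof.
move=> x0; apply/mx_normr_leP => [|r]; first by apply: sumr_ge0.
by rewrite ger0_norm // (bigD1 r) //= lerDl sumr_ge0.
Qed.

Lemma convex_set_comb (R : realType) (m : nat) (A : set 'rV[R]_m) x y (t : R) :
  convex_set A -> A x -> A y -> 0 <= t <= 1 -> A (t *: x + (1 - t) *: y).
Proof.
move=> cA Ax Ay /andP[t0 t1].
by have := cA x y (Itv01 t0 t1); rewrite !inE; apply.
Qed.

Lemma convex_set_avg (R : realType) (m : nat) (A : set 'rV[R]_m) (T : nat)
    (x : nat -> 'rV[R]_m) :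
  convex_set A -> (0 < T)%N -> (forall t, (t < T)%N -> A (x t.+1)) ->
  A (T%:R^-1 *: \sum_(1 <= t < T.+1) x t).
Proof.
move=> cA; elim: T => // -[_ _ h|T IH _ h].
  by rewrite big_nat1 invr1 scale1r; apply: h.
rewrite big_nat_recr //= scalerDr.
have hT : A (T.+1%:R^-1 *: \sum_(1 <= t < T.+2) x t).
  by apply: IH => // t tT; apply: h; rewrite ltnW.
(* The new average puts weight [q] on the previous average and [1 - q] on the last point. *)
pose q : R := T.+1%:R / T.+2%:R.
have q01 : 0 <= q <= 1.
  rewrite /q divr_ge0 ?ler0n //= ler_pdivrMr ?ltr0n // mul1r ler_nat; exact: leqnSn.
have := convex_set_comb cA hT (h T.+1 (ltnSn _)) q01; congr A.
rewrite scalerA /q; congr (_ *: _ + _ *: _).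
  by rewrite mulrAC divff ?mul1r ?pnatr_eq0.
have -> : T.+1%:R = T.+2%:R - 1 :> R by rewrite -[T.+2%:R]natr1 addrK.
by rewrite mulrBl divff ?pnatr_eq0 // mul1r subKr.
Qed.

(** * The loop of a customer *)

Definition posv (R : realType) (m : nat) (y : 'rV[R]_m) : Prop :=
  forall r, 0 < y 0 r.

Definition price_sum (R : realType) (m : nat) (S : {set 'I_m}) (y : 'rV[R]_m) : R :=
  \sum_(r in S) y 0 r.

Definition local_cost (R : realType) (m : nat) (f : 'rV[R]_m -> 'rV[R]_m)
    (S : {set 'I_m}) (y : 'rV[R]_m) : R :=
  \sum_(r in S) y 0 r * f y 0 r.

Lemma posv_nneg (R : realType) (m : nat) (y : 'rV[R]_m) : posv y -> nneg y.
Proof. by move=> h r; apply: ltW. Qed.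

Lemma price_update_posv (R : realType) (m : nat) (eps xi : R) (b y : 'rV[R]_m) :
  posv y -> posv (price_update eps xi b y).
Proof. by move=> h r; rewrite mxE mulr_gt0 ?expR_gt0. Qed.

(** The final alternative drives both termination and the count of calls: a step either completes
    the customer or adds a vector of maximum norm exactly 1. *)
Lemma step_sizeP (R : realType) (m : nat) (alpha : R) (b : 'rV[R]_m) :
  alpha < 1 ->
  [/\ 0 < step_size alpha b, alpha + step_size alpha b <= 1,
      step_size alpha b * `|b| <= 1
    & alpha + step_size alpha b = 1 \/ step_size alpha b * `|b| = 1].
Proof.
move=> a1; rewrite /step_size; case: eqP => [->|/eqP b0].
  by rewrite normr0 mulr0; split; [lra|lra|lra|left; lra].
have nb : 0 < `|b| by rewrite normr_gt0.
case: (leP (1 - alpha) `|b|^-1) => [le|lt].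
  split; [lra|lra| |by left; lra].
  by rewrite -ler_pdivlMr // div1r.
by rewrite mulVf ?gt_eqF //; split; [rewrite invr_gt0|lra| |right].
Qed.

Lemma step_size_coord (R : realType) (m : nat) (alpha : R) (b : 'rV[R]_m) r :
  alpha < 1 -> nneg b -> 0 <= step_size alpha b * b 0 r <= 1.
Proof.
move=> a1 b0; have [xi0 _ h _] := step_sizeP b a1.
rewrite mulr_ge0 ?(ltW xi0) //=; apply: le_trans h.
by rewrite ler_wpM2l ?(ltW xi0) // (le_trans (ler_norm _)) // ler_mx_normr.
Qed.

Lemma customer_run_price (R : realType) (m : nat) (f : 'rV[R]_m -> 'rV[R]_m)
    (eps alpha : R) y s k y' s' :
  customer_run f eps alpha y s k y' s' ->
  forall r, y' 0 r = y 0 r * expR (eps * (s' 0 r - s 0 r)).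
Proof.
elim=> {alpha y s k y' s'} [alpha y s _ r|alpha y s k y' s' _ /= _ IH r].
  by rewrite subrr mulr0 expR0 mulr1.
by rewrite IH !mxE -mulrA -expRD; congr (_ * expR _); ring.
Qed.

Lemma price_sum_update (R : realType) (m : nat) (f : 'rV[R]_m -> 'rV[R]_m)
    (eps alpha : R) (S : {set 'I_m}) y :
  alpha < 1 -> nneg y -> nneg (f y) ->
  let xi := step_size alpha (f y) in
  price_sum S (price_update eps xi (f y) y) - price_sum S y
    <= (expR eps - 1) * (xi * local_cost f S y).
Proof.
move=> a1 y0 fy0 /=; set xi := step_size _ _; rewrite /price_sum /local_cost.
rewrite -sumrB !mulr_sumr ler_sum // => r _.
have := ler_wpM2l (y0 r) (expR_le_chord eps (step_size_coord r a1 fy0)).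
by rewrite mxE -/xi -mulrA; lra.
Qed.

Section CustomerLoop.
Variables (R : realType) (m : nat) (A : set 'rV[R]_m).
Variables (f : 'rV[R]_m -> 'rV[R]_m) (eps : R).
Hypotheses (A_convex : convex_set A) (A_nneg : forall x, A x -> nneg x).
Hypotheses (A_f : forall y, nneg y -> A (f y)) (eps_gt0 : 0 < eps).

(** Convexity gathers the oracle answers, whose weights [xi] sum to the remaining [1 - alpha], into
    one point of [A]. Started with [alpha = 0] and [s = 0], the loop thus ends with a vector in
    [A]. *)
Lemma customer_run_in alpha y s k y' s' :
  customer_run f eps alpha y s k y' s' -> posv y -> alpha <= 1 ->
  exists2 x, A x & s' = s + (1 - alpha) *: x.
Proof.
elim=> {alpha y s k y' s'} [alpha y s a1 yp a2|alpha y s k y' s' a1 /= _ IH yp _].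
  (* The remaining weight is 0, so any point of [A] will do. *)
  exists (f y); first exact/A_f/posv_nneg.
  by have -> : 1 - alpha = 0 by [lra]; rewrite scale0r addr0.
have [xi0 axi _ _] := step_sizeP (f y) a1.
have [x Ax ->] := IH (price_update_posv _ _ _ yp) axi.
set xi := step_size _ _ in xi0 axi *.
have q01 : 0 <= xi / (1 - alpha) <= 1.
  by rewrite divr_ge0 ?ler_pdivrMr; lra.
exists (xi / (1 - alpha) *: f y + (1 - xi / (1 - alpha)) *: x).
  by apply: convex_set_comb => //; apply/A_f/posv_nneg.
have d0 : 1 - alpha != 0 by rewrite gt_eqF; lra.
rewrite scalerDr !scalerA addrA; congr (_ + _ *: _ + _ *: _); by field.
Qed.

Lemma customer_run_le alpha y s k y' s' :
  customer_run f eps alpha y s k y' s' -> posv y -> alpha <= 1 ->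
  forall r, s 0 r <= s' 0 r /\ y 0 r <= y' 0 r.
Proof.
move=> h yp a1 r; have [x /A_nneg x0 es] := customer_run_in h yp a1.
have ss : s 0 r <= s' 0 r.
  by rewrite es !mxE lerDl mulr_ge0 ?subr_ge0.
split=> //; rewrite (customer_run_price h) ler_peMr ?(ltW (yp r)) //.
by rewrite -expR0 ler_expR mulr_ge0 ?subr_ge0 // ltW.
Qed.

(* Every call but the last has [xi * `|f y| = 1], hence increases the sum of
   the coordinates of [s] by at least [1]. *)
Lemma customer_run_calls alpha y s k y' s' :
  customer_run f eps alpha y s k y' s' -> posv y -> alpha <= 1 ->
  k%:R <= (alpha < 1)%R%:R + \sum_r (s' 0 r - s 0 r).
Proof.
elim=> {alpha y s k y' s'} [alpha y s a1 _ _|alpha y s k y' s' a1 /= run IH yp _].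
  by rewrite addr_ge0 ?ler0n // sumr_ge0 // => r _; rewrite subrr.
have [xi0 axi _ alt] := step_sizeP (f y) a1.
have yp1 := price_update_posv eps (step_size alpha (f y)) (f y) yp.
have fy0 := A_nneg (A_f (posv_nneg yp)).
have {}IH := IH yp1 axi; rewrite a1 mulr1n.
set xi := step_size _ _ in xi0 axi alt IH run yp1 *.
have -> : \sum_r (s' 0 r - s 0 r)
    = \sum_r (s' 0 r - (s + xi *: f y) 0 r) + \sum_r (xi * f y 0 r).
  by rewrite -big_split /=; apply: eq_bigr => r _; rewrite !mxE; ring.
have sum0 : 0 <= \sum_r (s' 0 r - (s + xi *: f y) 0 r).
  by apply: sumr_ge0 => r _; rewrite subr_ge0; have [] := customer_run_le run yp1 axi r.
have xif0 : 0 <= \sum_r (xi * f y 0 r).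
  by apply: sumr_ge0 => r _; rewrite mulr_ge0 // ltW.
case: alt => alt.
  (* The weight is exhausted, so the rest of the run makes no call and [k = 0]. *)
  inversion run as [|? ? ? ? ? ? lt]; last by move: lt; rewrite alt ltxx.
  by subst; rewrite mulr1n; lra.
have : 1 <= \sum_r (xi * f y 0 r).
  rewrite -mulr_sumr -alt ler_wpM2l ?(ltW xi0) //.
  exact: norm_le_sum_nneg.
have : (alpha + xi < 1)%R%:R <= 1 :> R by case: (_ < _); rewrite ?lexx ?ler01.
rewrite -natr1; lra.
Qed.

(* The loop evaluates the oracle at several price vectors, with weights [xi]
   of sum [1 - alpha]; the costliest of them dominates the weighted sum. *)
Lemma customer_run_potential (S : {set 'I_m}) alpha y s k y' s' :
  customer_run f eps alpha y s k y' s' -> posv y -> alpha <= 1 ->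
  exists yb, [/\ nneg yb, forall r, yb 0 r <= y' 0 r &
    price_sum S y' - price_sum S y
      <= (expR eps - 1) * ((1 - alpha) * local_cost f S yb)].
Proof.
have eta0 : 0 <= expR eps - 1 by rewrite expRB1_ge0 // ltW.
elim=> {alpha y s k y' s'} [alpha y s a1 yp a2|alpha y s k y' s' a1 /= run IH yp a2].
  exists y; split => //; first exact: posv_nneg.
  by have -> : 1 - alpha = 0 by [lra]; rewrite mul0r mulr0 subrr.
have [xi0 axi _ _] := step_sizeP (f y) a1.
have yp1 := price_update_posv eps (step_size alpha (f y)) (f y) yp.
have h1 := price_sum_update eps S a1 (posv_nneg yp) (A_nneg (A_f (posv_nneg yp))).
have [yb [yb0 yble h2]] := IH yp1 axi.
have yle r : y 0 r <= y' 0 r by have [] := customer_run_le (customer_step a1 run) yp a2 r.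
move: h1 h2; rewrite /= .
set xi := step_size _ _ in xi0 axi *; set P1 := price_sum S (price_update _ _ _ _).
set g := local_cost f S y; set gb := local_cost f S yb => h1 h2.
(* [G] stands for the larger of the current cost [g] and the later cost [gb]; the weights [xi] and
   [1 - (alpha + xi)] add up to [1 - alpha]. *)
have comb G : g <= G -> gb <= G -> price_sum S y' - price_sum S y
    <= (expR eps - 1) * ((1 - alpha) * G).
  move=> gG gbG.
  have : xi * g <= xi * G by rewrite ler_wpM2l // ltW.
  have : (1 - (alpha + xi)) * gb <= (1 - (alpha + xi)) * G by rewrite ler_wpM2l //; lra.
  move=> /(ler_wpM2l eta0) ? /(ler_wpM2l eta0); lra.
case: (leP g gb) => gg.
  by exists yb; split => //; apply: comb.
by exists y; split => //; [exact: posv_nneg | apply: comb => //; apply: ltW].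
Qed.

End CustomerLoop.

(** * Optima and termination *)

Lemma coord_le_price_sum (R : realType) (m : nat) (S : {set 'I_m})
    (y : 'rV[R]_m) r : nneg y -> r \in S -> y 0 r <= price_sum S y.
Proof.
by move=> y0 rS; rewrite /price_sum (bigD1 r) //= lerDl sumr_ge0.
Qed.

Lemma price_sum_ge0 (R : realType) (m : nat) (S : {set 'I_m}) (y : 'rV[R]_m) :
  nneg y -> 0 <= price_sum S y.
Proof. by move=> y0; apply: sumr_ge0. Qed.

Lemma dot_setT (R : realType) (m : nat) (y x : 'rV[R]_m) :
  \sum_(r in [set: 'I_m]%SET) y 0 r * x 0 r = dot y x.
Proof. by apply: eq_bigl => r; rewrite inE. Qed.

Lemma dot_ge0 (R : realType) (m : nat) (y x : 'rV[R]_m) :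
  nneg y -> nneg x -> 0 <= dot y x.
Proof. by move=> y0 x0; apply: sumr_ge0 => r _; rewrite mulr_ge0. Qed.

Lemma dot_le_norm (R : realType) (m : nat) (y x : 'rV[R]_m) :
  nneg y -> dot y x <= `|x| * price_sum finset.setT y.
Proof.
move=> y0; rewrite -dot_setT mulr_sumr ler_sum // => r _.
by rewrite mulrC ler_wpM2r // (le_trans (ler_norm _)) // ler_mx_normr.
Qed.

Lemma has_lbound_dot (R : realType) (m : nat) (A : set 'rV[R]_m) (y : 'rV[R]_m) :
  (forall x, A x -> nneg x) -> nneg y -> has_lbound [set dot y x | x in A].
Proof. by move=> A0 y0; exists 0 => _ [x /A0 x0 <-]; apply: dot_ge0. Qed.

Lemma opt_le (R : realType) (m : nat) (A : set 'rV[R]_m) (y x : 'rV[R]_m) :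
  (forall x, A x -> nneg x) -> nneg y -> A x -> opt A y <= dot y x.
Proof. by move=> A0 y0 Ax; apply: ge_inf; [apply: has_lbound_dot|exists x]. Qed.

Lemma le_opt (R : realType) (m : nat) (A : set 'rV[R]_m) (y : 'rV[R]_m) (v : R) :
  A !=set0 -> (forall x, A x -> v <= dot y x) -> v <= opt A y.
Proof.
move=> [x0 Ax0] h; apply: lb_le_inf; first by exists (dot y x0), x0.
by move=> _ [x Ax <-]; apply: h.
Qed.

Lemma opt_ge0 (R : realType) (m : nat) (A : set 'rV[R]_m) (y : 'rV[R]_m) :
  A !=set0 -> (forall x, A x -> nneg x) -> nneg y -> 0 <= opt A y.
Proof. by move=> An A0 y0; apply: le_opt => // x Ax; apply: dot_ge0 => //; apply: A0. Qed.

Lemma opt_mono (R : realType) (m : nat) (A : set 'rV[R]_m) (y y' : 'rV[R]_m) :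
  A !=set0 -> (forall x, A x -> nneg x) -> nneg y ->
  (forall r, y 0 r <= y' 0 r) -> opt A y <= opt A y'.
Proof.
move=> An A0 y0 yy; apply: le_opt => // x Ax; apply: le_trans (opt_le A0 y0 Ax) _.
by apply: ler_sum => r _; rewrite ler_wpM2r //; apply: A0.
Qed.

Section Termination.
Variables (R : realType) (m : nat) (f : 'rV[R]_m -> 'rV[R]_m) (eps D : R).
Hypotheses (eps_gt0 : 0 < eps) (f_nneg : forall y, nneg y -> nneg (f y)).
Hypotheses (D_ge0 : 0 <= D)
  (f_cost : forall y, nneg y -> dot y (f y) <= D * price_sum finset.setT y).

(** An unfinished customer has [xi * |f y| = 1], and the maximum norm is at most the coordinate sum,
    which is what the logarithms pick up, scaled by [eps]. *)
Lemma price_update_ln alpha y : posv y ->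
  let xi := step_size alpha (f y) in
  alpha < 1 -> alpha + xi < 1 ->
  \sum_r ln (y 0 r) + eps <= \sum_r ln (price_update eps xi (f y) y 0 r).
Proof.
move=> yp /= a1; have [xi0 _ _] := step_sizeP (f y) a1.
set xi := step_size _ _ in xi0 *; case=> [->|xib _]; first by rewrite ltxx.
have fy0 := f_nneg (posv_nneg yp).
under [leRHS]eq_bigr do rewrite mxE lnM ?posrE ?expR_gt0 // expRK -mulrA.
rewrite big_split /= lerD2l -mulr_sumr ler_peMr ?(ltW eps_gt0) //.
rewrite -mulr_sumr -xib ler_wpM2l ?(ltW xi0) //.
exact: norm_le_sum_nneg.
Qed.

(* The sum of the prices stays bounded, while every call but the last
   multiplies some price by [expR eps]. *)
Lemma customer_run_bounded (M : R) (N : nat) alpha y s :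
  alpha <= 1 -> posv y ->
  price_sum finset.setT y <= expR (M + (expR eps - 1) * D * alpha) ->
  m%:R * (M + (expR eps - 1) * D) < \sum_r ln (y 0 r) + eps * N%:R ->
  exists k y' s', customer_run f eps alpha y s k y' s'.
Proof.
have eta0 : 0 <= expR eps - 1 by rewrite expRB1_ge0 // ltW.
have etaD0 : 0 <= (expR eps - 1) * D by rewrite mulr_ge0.
elim: N alpha y s => [|N IH] alpha y s a1 yp hy hN.
  (* With no calls left the hypotheses clash: every price is at most the price sum, so its logarithm
     is at most [M + (expR eps - 1) * D]. *)
  exfalso; move: hN; rewrite mulr0 addr0 ltNge => /negP; apply.
  rewrite -[m in m%:R]card_ord mulr_natl -sumr_const ler_sum // => r _.
  rewrite -[leRHS]expRK ler_ln ?posrE ?expR_gt0 //.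
  apply: le_trans (coord_le_price_sum (posv_nneg yp) (finset.in_setT r)) _.
  apply: le_trans hy _; rewrite ler_expR lerD2l ler_piMr //.
have [a1'|{}a1] := leP 1 alpha.
  by exists 0%N, y, s; apply: customer_stop.
have yp1 := price_update_posv eps (step_size alpha (f y)) (f y) yp.
have [xi0 axi _ _] := step_sizeP (f y) a1.
have hln := price_update_ln yp a1.
suff [k [y' [s' run]]] : exists k y' s',
    customer_run f eps (alpha + step_size alpha (f y))
      (price_update eps (step_size alpha (f y)) (f y) y)
      (s + step_size alpha (f y) *: f y) k y' s'.
  by exists k.+1, y', s'; apply: customer_step.
have [ge|lt] := leP 1 (alpha + step_size alpha (f y)).
  by eexists 0%N, _, _; apply: customer_stop.
apply: IH => //; last first.
  by have := hln lt; move: hN; rewrite -natr1; lra.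
set xi := step_size _ _ in xi0 *.
have -> : M + (expR eps - 1) * D * (alpha + xi)
    = M + (expR eps - 1) * D * alpha + (expR eps - 1) * D * xi by ring.
rewrite expRD.
(* The growth factor [1 + u] of one step is at most [expR u], exactly what the invariant gains when
   [alpha] grows by [xi]. *)
have : price_sum finset.setT (price_update eps xi (f y) y)
    <= price_sum finset.setT y * (1 + (expR eps - 1) * D * xi).
  have := price_sum_update eps [set: 'I_m]%SET a1 (posv_nneg yp) (f_nneg (posv_nneg yp)).
  rewrite /local_cost dot_setT -/xi.
  have := ler_wpM2l eta0 (ler_wpM2l (ltW xi0) (f_cost (posv_nneg yp))); lra.
move/le_trans; apply; apply: ler_pM => //.
- exact/price_sum_ge0/posv_nneg.
- by rewrite addr_ge0 // mulr_ge0 // ltW.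
- exact: expR_ge1Dx.
Qed.

End Termination.

Lemma customer_run_total (R : realType) (m : nat) (sigma : R)
    (A : set 'rV[R]_m) (f : 'rV[R]_m -> 'rV[R]_m) (eps : R) y :
  0 <= sigma -> 0 < eps -> A !=set0 -> (forall x, A x -> nneg x) ->
  is_oracle sigma A f -> posv y ->
  exists k y' s', customer_run f eps 0 y 0 k y' s'.
Proof.
move=> sigma0 eps0 [x0 Ax0] A0 Af yp.
(* Any fixed point [x0] bounds the optimum at prices [y1] by [|x0|] times the price sum. *)
pose D := sigma * `|x0|.
have D0 : 0 <= D by rewrite mulr_ge0.
have f0 y1 : nneg y1 -> nneg (f y1) by move=> /Af[/A0].
have fD y1 : nneg y1 -> dot y1 (f y1) <= D * price_sum finset.setT y1.
  move=> y10; have [_ /le_trans] := Af _ y10; apply.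
  rewrite -mulrA ler_wpM2l //; apply: le_trans (opt_le A0 y10 Ax0) _.
  exact: dot_le_norm.
pose M := price_sum finset.setT y.
pose Q := m%:R * (M + (expR eps - 1) * D) - \sum_r ln (y 0 r).
(* [M] works because [M <= expR M], and [N] is chosen so that [eps * N] exceeds [Q]. *)
apply: (customer_run_bounded eps0 f0 D0 fD (M := M)
  (N := (Num.truncn (Q / eps)).+1)) => //.
  by rewrite mulr0 addr0; apply: le_trans (expR_ge1Dx _); rewrite lerDr.
by have := truncnS_gt (Q / eps); rewrite ltr_pdivrMr // /Q; lra.
Qed.

(** * Phases *)

Lemma phase_run_price (R : realType) (m : nat) (C : finType)
    (f : C -> 'rV[R]_m -> 'rV[R]_m) (eps : R) cs y k y' s :
  phase_run f eps cs y k y' s ->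
  forall r, y' 0 r = y 0 r * expR (eps * s 0 r).
Proof.
elim=> {cs y k y' s} [y r|c cs y k1 y1 s1 k2 y2 s2 run1 _ IH r].
  by rewrite mxE mulr0 expR0 mulr1.
rewrite IH (customer_run_price run1) -mulrA -expRD !mxE.
by congr (_ * expR _); ring.
Qed.

Lemma phase_run_posv (R : realType) (m : nat) (C : finType)
    (f : C -> 'rV[R]_m -> 'rV[R]_m) (eps : R) cs y k y' s :
  phase_run f eps cs y k y' s -> posv y -> posv y'.
Proof. by move=> run yp r; rewrite (phase_run_price run) mulr_gt0 ?expR_gt0. Qed.

Lemma customer_run_posv (R : realType) (m : nat) (f : 'rV[R]_m -> 'rV[R]_m)
    (eps alpha : R) y s k y' s' :
  customer_run f eps alpha y s k y' s' -> posv y -> posv y'.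
Proof. by move=> run yp r; rewrite (customer_run_price run) mulr_gt0 ?expR_gt0. Qed.

(** * Weak duality on the Minkowski sum *)

Section Minkowski.
Variables (R : realType) (m : nat) (C : finType) (X : C -> set 'rV[R]_m).
Hypotheses (X_neq0 : forall c, X c !=set0) (X_nneg : forall c x, X c x -> nneg x).

Lemma minkowski_sum_neq0 : minkowski_sum X !=set0.
Proof.
have [x Xx] := choice X_neq0.
by exists (\sum_c x c), x.
Qed.

Lemma minkowski_sum_nneg x : minkowski_sum X x -> nneg x.
Proof.
move=> [u Xu <-] r; rewrite summxE sumr_ge0 // => c _; exact: X_nneg (Xu c) r.
Qed.

Lemma sum_opt_le y : nneg y -> \sum_c opt (X c) y <= opt (minkowski_sum X) y.
Proof.
move=> y0; apply: le_opt minkowski_sum_neq0 _ => _ [u Xu <-].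
have -> : dot y (\sum_c u c) = \sum_c dot y (u c).
  rewrite /dot exchange_big /=; apply: eq_bigr => r _.
  by rewrite summxE mulr_sumr.
by apply: ler_sum => c _; apply: opt_le (X_nneg (c := c)) y0 (Xu c).
Qed.

Lemma has_lbound_norm (A : set 'rV[R]_m) : has_lbound [set `|x| | x in A].
Proof. by exists 0 => _ [x _ <-]. Qed.

Lemma lambda_star_le x : minkowski_sum X x -> lambda_star X <= `|x|.
Proof. by move=> Xx; apply: ge_inf; [exact: has_lbound_norm|exists x]. Qed.

(** Weak duality: every feasible [x] costs at most [|x|] times the price sum. Dividing by that sum
    requires treating zero prices separately. *)
Lemma opt_le_lambda_star y : nneg y ->
  opt (minkowski_sum X) y <= lambda_star X * price_sum finset.setT y.
Proof.
move=> y0; have [x0 Xx0] := minkowski_sum_neq0.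
have [P0|P0] := eqVneq (price_sum finset.setT y) 0.
  rewrite P0 mulr0; apply: le_trans (opt_le minkowski_sum_nneg y0 Xx0) _.
  by apply: le_trans (dot_le_norm _ y0) _; rewrite P0 mulr0.
have Pp : 0 < price_sum finset.setT y by rewrite lt_def P0 price_sum_ge0.
rewrite -ler_pdivrMr //; apply: lb_le_inf; first by exists `|x0|, x0.
move=> _ [x Xx <-]; rewrite ler_pdivrMr //.
exact: le_trans (opt_le minkowski_sum_nneg y0 Xx) (dot_le_norm _ y0).
Qed.

End Minkowski.

(** * One phase: termination, feasibility, calls and potential *)

Section Phase.
Variables (R : realType) (m : nat) (C : finType) (X : C -> set 'rV[R]_m).
Variables (f : C -> 'rV[R]_m -> 'rV[R]_m) (eps sigma : R).
Hypotheses (X_neq0 : forall c, X c !=set0) (X_convex : forall c, convex_set (X c)).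
Hypotheses (X_nneg : forall c x, X c x -> nneg x).
Hypotheses (f_oracle : forall c, is_oracle sigma (X c) (f c)).
Hypotheses (eps_gt0 : 0 < eps) (sigma_ge0 : 0 <= sigma).

Let X_f c y : nneg y -> X c (f c y). Proof. by move=> y0; have [] := f_oracle c y0. Qed.

Lemma phase_run_total cs y : posv y ->
  exists k y' s, phase_run f eps cs y k y' s.
Proof.
elim: cs y => [|c cs IH] y yp; first by exists 0%N, y, 0; apply: phase_nil.
have [k1 [y1 [s1 run1]]] := customer_run_total sigma_ge0 eps_gt0 (X_neq0 c)
  (@X_nneg c) (f_oracle c) yp.
have [k2 [y2 [s2 run2]]] := IH y1 (customer_run_posv run1 yp).
by exists (k1 + k2)%N, y2, (s1 + s2); apply: phase_cons run1 run2.
Qed.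

Lemma phase_run_in cs y k y' s : phase_run f eps cs y k y' s ->
  uniq cs -> posv y ->
  exists2 x : C -> 'rV[R]_m, forall c, X c (x c) & s = \sum_(c <- cs) x c.
Proof.
elim=> {cs y k y' s} [y _ yp|c cs y k1 y1 s1 k2 y2 s2 run1 _ IH /= /andP[ncs ucs] yp].
  by exists (fun c => f c y) => [c|]; [exact/X_f/posv_nneg|rewrite big_nil].
have [x Xx ->] := IH ucs (customer_run_posv run1 yp).
have [x1 Xx1 ->] := customer_run_in (@X_convex c) (@X_f c) run1 yp ler01.
(* Overriding the choice at [c] leaves the sum over [cs] unchanged, because [c] does not occur in
   [cs]. *)
exists (fun d => if d == c then x1 else x d) => [d|].
  by case: eqP => [->|].
rewrite big_cons eqxx add0r subr0 scale1r; congr (_ + _).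
by apply: eq_big_seq => d dcs; case: eqP => // dc; rewrite -dc dcs in ncs.
Qed.

Lemma phase_run_nneg cs y k y' s : phase_run f eps cs y k y' s ->
  uniq cs -> posv y -> nneg s.
Proof.
move=> run ucs yp r; have [x Xx ->] := phase_run_in run ucs yp.
by rewrite summxE sumr_ge0 // => c _; apply: X_nneg (Xx c) r.
Qed.

Lemma phase_run_le cs y k y' s : phase_run f eps cs y k y' s ->
  uniq cs -> posv y -> forall r, y 0 r <= y' 0 r.
Proof.
move=> run ucs yp r; rewrite (phase_run_price run) ler_peMr ?(ltW (yp r)) //.
by rewrite -expR0 ler_expR mulr_ge0 ?(ltW eps_gt0) //; apply: phase_run_nneg run _ _ _.
Qed.

(** Each customer is charged one final call, and all other calls are paid for by the load they
    create. *)
Lemma phase_run_calls cs y k y' s : phase_run f eps cs y k y' s ->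
  posv y -> k%:R <= (size cs)%:R + \sum_r s 0 r.
Proof.
elim=> {cs y k y' s} [y yp|c cs y k1 y1 s1 k2 y2 s2 run1 _ IH yp].
  by rewrite add0r sumr_ge0 // => r _; rewrite mxE.
have h1 := customer_run_calls (@X_convex c) (@X_nneg c) (@X_f c) eps_gt0 run1 yp ler01.
have h2 := IH (customer_run_posv run1 yp).
have -> : \sum_r (s1 + s2) 0 r = \sum_r (s1 0 r - (0 : 'rV[R]_m) 0 r) + \sum_r s2 0 r.
  by rewrite -big_split; apply: eq_bigr => r _; rewrite !mxE subr0.
move: h1 h2; rewrite ltr01 mulr1n natrD /= -natr1; lra.
Qed.

(** One price vector per customer is the format of [local_weak_duality]; domination by the final
    prices [y'] lets all these vectors be replaced by [y'] afterwards. *)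
Lemma phase_run_potential (S : {set 'I_m}) cs y k y' s :
  phase_run f eps cs y k y' s -> uniq cs -> posv y ->
  exists yb : C -> 'rV[R]_m,
    [/\ forall c, nneg (yb c), forall c r, yb c 0 r <= y' 0 r &
    price_sum S y' - price_sum S y
      <= (expR eps - 1) * \sum_(c <- cs) local_cost (f c) S (yb c)].
Proof.
elim=> {cs y k y' s} [y _ yp|c cs y k1 y1 s1 k2 y2 s2 run1 run2 IH /= /andP[ncs ucs] yp].
  exists (fun=> y); split => [c||]; [exact: posv_nneg|by []|].
  by rewrite subrr big_nil mulr0.
have yp1 := customer_run_posv run1 yp.
have [yb [yb0 yble h2]] := IH ucs yp1.
have [y0 [y00 y0le h1]] := customer_run_potential (@X_convex c) (@X_nneg c)
  (@X_f c) eps_gt0 S run1 yp ler01.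
exists (fun d => if d == c then y0 else yb d); split.
- by move=> d; case: eqP.
- move=> d r; case: eqP => // _; apply: le_trans (y0le r) _.
  exact: (phase_run_le run2).
rewrite big_cons eqxx mulrDr.
have -> : \sum_(d <- cs) local_cost (f d) S (if d == c then y0 else yb d)
    = \sum_(d <- cs) local_cost (f d) S (yb d).
  by apply: eq_big_seq => d dcs; case: eqP => // dc; rewrite -dc dcs in ncs.
by move: h1; rewrite subr0 mul1r; lra.
Qed.

Lemma phase_run_duality (S : {set 'I_m}) (mu : R) cs y k y' s :
  perm_eq cs (enum C) -> 0 <= mu -> local_weak_duality f S mu ->
  phase_run f eps cs y k y' s -> posv y ->
  price_sum S y' - price_sum S y <= (expR eps - 1) * mu * price_sum S y'.
Proof.
move=> pcs mu0 lwd run yp; have ucs : uniq cs by rewrite (perm_uniq pcs) enum_uniq.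
have [yb [yb0 yble /le_trans]] := phase_run_potential S run ucs yp; apply.
rewrite (perm_big _ pcs) /= big_enum /= -mulrA.
rewrite ler_wpM2l ?expRB1_ge0 ?(ltW eps_gt0) //.
apply: le_trans (lwd yb yb0) _; rewrite ler_wpM2l // ler_sum // => r _.
by apply: bigmax_le => //; apply/ltW/(phase_run_posv run).
Qed.

(** The oracle guarantee turns each local cost into [sigma] times an optimum at [yb c]; monotonicity
    moves it to [y'], where the optima of the customers add up to at most that of the sum. *)
Lemma phase_run_growth cs y k y' s :
  perm_eq cs (enum C) -> phase_run f eps cs y k y' s -> posv y ->
  price_sum finset.setT y' - price_sum finset.setT y
    <= (expR eps - 1) * sigma * opt (minkowski_sum X) y'.
Proof.
move=> pcs run yp; have ucs : uniq cs by rewrite (perm_uniq pcs) enum_uniq.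
have [yb [yb0 yble /le_trans]] := phase_run_potential finset.setT run ucs yp; apply.
rewrite (perm_big _ pcs) /= big_enum /= -mulrA.
rewrite ler_wpM2l ?expRB1_ge0 ?(ltW eps_gt0) //.
have y'0 := posv_nneg (phase_run_posv run yp).
apply: le_trans (ler_wpM2l sigma_ge0 (sum_opt_le X_neq0 X_nneg y'0)).
rewrite mulr_sumr ler_sum // => c _; rewrite /local_cost dot_setT.
have [_ /le_trans] := f_oracle c (yb0 c); apply.
by rewrite ler_wpM2l // opt_mono //; apply: X_nneg.
Qed.

Lemma core_run_total T cs : exists y s k, core_run f eps T cs y s k.
Proof.
(* Selecting one phase for every positive price vector makes the run an iteration of a function;
   other vectors receive dummy values, never reached from the initial prices. *)
have /choice[g gP] : forall y, exists w : nat * 'rV[R]_m * 'rV[R]_m,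
    posv y -> phase_run f eps cs y w.1.1 w.1.2 w.2.
  move=> y; have [yp|nyp] := pselect (posv y); last by exists (0%N, 0, 0).
  by have [k [y' [s run]]] := phase_run_total cs yp; exists (k, y', s).
pose y t := iter t (fun y => (g y).1.2) (const_mx 1).
have yp t : posv (y t).
  elim: t => [r|t IH]; first by rewrite mxE.
  exact: (phase_run_posv (gP _ IH) IH).
exists y, (fun t => (g (y t.-1)).2), (fun t => (g (y t.-1)).1.1); split => //.
by move=> [|t] // _; apply: gP.
Qed.

End Phase.

(** * The core algorithm *)

Section Core.
Variables (R : realType) (m : nat) (C : finType) (X : C -> set 'rV[R]_m).
Variables (f : C -> 'rV[R]_m -> 'rV[R]_m) (eps sigma : R) (T : nat) (cs : seq C).
Variables (y s : nat -> 'rV[R]_m) (k : nat -> nat).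
Hypotheses (X_neq0 : forall c, X c !=set0) (X_convex : forall c, convex_set (X c)).
Hypotheses (X_nneg : forall c x, X c x -> nneg x).
Hypotheses (f_oracle : forall c, is_oracle sigma (X c) (f c)).
Hypotheses (eps_gt0 : 0 < eps) (sigma_ge0 : 0 <= sigma) (T_gt0 : (0 < T)%N).
Hypotheses (m_gt0 : (0 < m)%N) (pcs : perm_eq cs (enum C)).
Hypothesis (run : core_run f eps T cs y s k).

Let ucs : uniq cs. Proof. by rewrite (perm_uniq pcs) enum_uniq. Qed.

Let run_phase t : (t < T)%N -> phase_run f eps cs (y t) (k t.+1) (y t.+1) (s t.+1).
Proof. by move=> tT; apply: (run.2 t.+1). Qed.

Lemma core_run_posv t : (t <= T)%N -> posv (y t).
Proof.
elim: t => [_ r|t IH tT]; first by rewrite run.1 mxE.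
exact: phase_run_posv (run_phase tT) (IH (ltnW tT)).
Qed.

Lemma core_run_nneg t : (t < T)%N -> nneg (s t.+1).
Proof.
move=> tT; apply: (phase_run_nneg X_convex X_nneg f_oracle (run_phase tT) ucs).
exact/core_run_posv/ltnW.
Qed.

Lemma core_run_price t r : (t <= T)%N ->
  y t 0 r = expR (eps * \sum_(1 <= u < t.+1) s u 0 r).
Proof.
elim: t => [_|t IH tT]; first by rewrite run.1 mxE big_geq // mulr0 expR0.
rewrite big_nat_recr //= mulrDr expRD -(IH (ltnW tT)).
exact: phase_run_price (run_phase tT) r.
Qed.

Lemma primal_outputE r :
  primal_output T s 0 r = T%:R^-1 * \sum_(1 <= t < T.+1) s t 0 r.
Proof. by rewrite mxE summxE. Qed.

Lemma primal_output_nneg : nneg (primal_output T s).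
Proof.
move=> r; rewrite primal_outputE mulr_ge0 ?invr_ge0 ?ler0n //.
rewrite big_add1 /= big_nat sumr_ge0 // => t /andP[_ tT]; exact: core_run_nneg.
Qed.

Lemma primal_output_in : minkowski_sum X (primal_output T s).
Proof.
(* Each phase vector splits into one point per customer; averaging these over the phases, customer
   by customer, decomposes the output. *)
have /choice[x xP] : forall t, exists x : C -> 'rV[R]_m, (t < T)%N ->
    (forall c, X c (x c)) /\ s t.+1 = \sum_c x c.
  move=> t; have [tT|] := ltnP t T; last by exists (fun=> 0).
  have [x Xx ->] := phase_run_in X_convex f_oracle (run_phase tT) ucs
    (core_run_posv (ltnW tT)).
  by exists x => _; split => //; rewrite (perm_big _ pcs) /= big_enum.
exists (fun c => T%:R^-1 *: \sum_(1 <= t < T.+1) x t.-1 c).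
  by move=> c; apply: convex_set_avg => // t tT; have [] := xP t tT.
rewrite -scaler_sumr exchange_big /=; congr (_ *: _).
rewrite !big_add1 /= !big_nat; apply: eq_bigr => t /andP[_ tT].
by have [_ ->] := xP t tT.
Qed.

(** The left side is the logarithm of the final price of [r], which is at most the final price sum
    over [S]; the sum starts at [#|S| <= m], whence [ln m%:R]. *)
Lemma core_run_potential (S : {set 'I_m}) (a : nat -> R) (th : R) :
  th < 1 -> (forall t, (t < T)%N -> 0 <= a t.+1 <= th) ->
  (forall t, (t < T)%N -> price_sum S (y t.+1) - price_sum S (y t)
     <= a t.+1 * price_sum S (y t.+1)) ->
  forall r, r \in S -> eps * T%:R * primal_output T s 0 r
    <= ln m%:R + (\sum_(1 <= t < T.+1) a t) / (1 - th).
Proof.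
move=> th1 ha hP r rS.
have T0 : T%:R != 0 :> R by rewrite pnatr_eq0 -lt0n.
rewrite primal_outputE mulrA mulfK // -ler_expR expRD -core_run_price //.
apply: le_trans (coord_le_price_sum (posv_nneg (core_run_posv (leqnn T))) rS) _.
have S0 := price_sum_ge0 S (posv_nneg (core_run_posv (leq0n T))).
apply: le_trans (potential_growth th1 S0 ha hP) _.
rewrite ler_wpM2r ?expR_ge0 // lnK ?posrE ?ltr0n //.
rewrite /price_sum run.1; under eq_bigr do rewrite mxE.
by rewrite sumr_const ler_nat -[leqRHS]card_ord max_card.
Qed.

Lemma dual_output_in : simplex (dual_output T y).
Proof.
have Ty0 t : (t < T)%N -> 0 < l1norm (y t.+1).
  move=> tT; have yp := core_run_posv tT.
  rewrite /l1norm (bigD1 (Ordinal m_gt0)) //= ltr_pwDl ?sumr_ge0 //.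
  by rewrite normr_gt0 gt_eqF.
have z0 r : 0 <= dual_output T y 0 r.
  rewrite mxE mulr_ge0 ?invr_ge0 ?ler0n // summxE big_add1 /= big_nat.
  apply: sumr_ge0 => t /andP[_ tT]; rewrite mxE mulr_ge0 //.
    by rewrite invr_ge0 ltW ?Ty0.
  exact/ltW/core_run_posv.
have z1 : l1norm (dual_output T y) = 1.
  rewrite /l1norm; under eq_bigr do rewrite ger0_norm // mxE summxE.
  rewrite -mulr_sumr exchange_big /=.
  have -> : \sum_(1 <= t < T.+1) \sum_r ((l1norm (y t))^-1 *: y t) 0 r
      = \sum_(1 <= t < T.+1) 1.
    rewrite !big_add1 /= !big_nat; apply: eq_bigr => t /andP[_ tT].
    under eq_bigr do rewrite mxE; rewrite -mulr_sumr.
    rewrite -[X in _ * X](_ : l1norm (y t.+1) = _) ?mulVf ?gt_eqF ?Ty0 //.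
    by apply: eq_bigr => r _; rewrite ger0_norm //; apply/ltW/core_run_posv.
  by rewrite sumr_const_nat subSS subn0 mulVf // pnatr_eq0 -lt0n.
split=> // r; rewrite z0 /= -z1 /l1norm (bigD1 r) //= ger0_norm //.
by rewrite lerDl sumr_ge0.
Qed.

Definition dual_value (t : nat) : R :=
  opt (minkowski_sum X) (y t) / price_sum finset.setT (y t).

Lemma core_price_sum_gt0 t : (t <= T)%N -> 0 < price_sum finset.setT (y t).
Proof.
move=> tT; have yp := core_run_posv tT.
apply: lt_le_trans (yp (Ordinal m_gt0)) _.
by apply: coord_le_price_sum; [exact: posv_nneg|rewrite inE].
Qed.

Lemma dual_value_itv t : (t <= T)%N -> 0 <= dual_value t <= lambda_star X.
Proof.
move=> tT; have P0 := core_price_sum_gt0 tT.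
have y0 := posv_nneg (core_run_posv tT).
rewrite divr_ge0 ?(ltW P0) ?opt_ge0 //=; first last.
- exact: minkowski_sum_nneg.
- exact: minkowski_sum_neq0.
by rewrite ler_pdivrMr // opt_le_lambda_star.
Qed.

(** A minimum of linear functions is concave in the prices: against any [x], each normalised price
    vector already pays its own [dual_value]. *)
Lemma opt_dual_output :
  T%:R^-1 * \sum_(1 <= t < T.+1) dual_value t
    <= opt (minkowski_sum X) (dual_output T y).
Proof.
apply: le_opt; first exact: minkowski_sum_neq0.
move=> x Xx.
have -> : dot (dual_output T y) x
    = T%:R^-1 * \sum_(1 <= t < T.+1) (l1norm (y t))^-1 * dot (y t) x.
  rewrite /dot mulr_sumr.
  under [RHS]eq_bigr do rewrite mulrA mulr_sumr.
  rewrite exchange_big /=; apply: eq_bigr => r _.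
  rewrite mxE summxE mulr_sumr mulr_suml; apply: eq_bigr => t _.
  by rewrite mxE !mulrA.
rewrite ler_wpM2l ?invr_ge0 ?ler0n // !big_add1 /= !big_nat.
apply: ler_sum => t /andP[_ tT]; have y0 := posv_nneg (core_run_posv tT).
have -> : l1norm (y t.+1) = price_sum finset.setT (y t.+1).
  by apply: eq_big => [r|r _]; rewrite ?inE // ger0_norm.
rewrite /dual_value mulrC ler_wpM2l ?invr_ge0 ?(ltW (core_price_sum_gt0 tT)) //.
by apply: opt_le => //; apply: minkowski_sum_nneg.
Qed.

Lemma core_run_growth (th : R) :
  (expR eps - 1) * sigma * lambda_star X <= th -> th < 1 ->
  forall r, eps * T%:R * primal_output T s 0 r <= ln m%:R
    + (expR eps - 1) * sigma * (\sum_(1 <= t < T.+1) dual_value t) / (1 - th).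
Proof.
move=> hth th1 r; rewrite mulr_sumr.
have es0 : 0 <= (expR eps - 1) * sigma.
  by rewrite mulr_ge0 // expRB1_ge0 // ltW.
apply: (core_run_potential (S := finset.setT) th1); last by rewrite inE.
  move=> t tT; have /andP[d0 d1] := dual_value_itv tT.
  by rewrite mulr_ge0 //= (le_trans _ hth) // ler_wpM2l.
move=> t tT; rewrite -[leRHS]mulrA divfK ?gt_eqF ?core_price_sum_gt0 //.
apply: (phase_run_growth X_neq0 X_convex X_nneg f_oracle eps_gt0 sigma_ge0 pcs
  (run_phase tT)).
exact/core_run_posv/ltnW.
Qed.

Lemma core_run_local (S : {set 'I_m}) (mu th : R) : 0 <= mu ->
  local_weak_duality f S mu -> (expR eps - 1) * mu <= th -> th < 1 ->
  forall r, r \in S -> eps * T%:R * primal_output T s 0 r <= ln m%:R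
    + (expR eps - 1) * mu * T%:R / (1 - th).
Proof.
move=> mu0 lwd hth th1 r rS.
have -> : (expR eps - 1) * mu * T%:R = \sum_(1 <= t < T.+1) (expR eps - 1) * mu.
  by rewrite sumr_const_nat subSS subn0 mulr_natr.
apply: (core_run_potential th1 _ _ rS) => t tT.
  by rewrite hth andbT mulr_ge0 // expRB1_ge0 // ltW.
apply: (phase_run_duality X_convex X_nneg f_oracle eps_gt0 pcs mu0 lwd
  (run_phase tT)).
exact/core_run_posv/ltnW.
Qed.

(** Summed over all phases, the load of each of the [m] resources is [T] times a coordinate of the
    output. *)
Lemma core_run_calls : (\sum_(1 <= t < T.+1) k t)%:R
  <= T%:R * (#|C|%:R + m%:R * `|primal_output T s|).
Proof.
have -> : T%:R * (#|C|%:R + m%:R * `|primal_output T s|)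
    = \sum_(1 <= t < T.+1) #|C|%:R
      + \sum_(r < m) T%:R * `|primal_output T s|.
  rewrite sumr_const_nat subSS subn0 sumr_const card_ord mulrDr.
  by congr (_ + _); rewrite -[RHS]mulr_natl // mulrCA.
apply: (@le_trans _ _ (\sum_(1 <= t < T.+1) #|C|%:R
    + \sum_(r < m) \sum_(1 <= t < T.+1) s t 0 r)).
  rewrite exchange_big -big_split natr_sum /= !big_add1 /= !big_nat.
  apply: ler_sum => t /andP[_ tT].
  have -> : #|C| = size cs by rewrite (perm_size pcs) cardE.
  apply: (phase_run_calls X_convex X_nneg f_oracle eps_gt0 (run_phase tT)).
  exact/core_run_posv/ltnW.
rewrite lerD2l ler_sum // => r _.
have := ler_wpM2l (ler0n R T) (ler_mx_normr (primal_output T s) r).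
rewrite ger0_norm; last exact: primal_output_nneg.
by rewrite primal_outputE mulrA divff ?mul1r // pnatr_eq0 -lt0n.
Qed.

End Core.

(** * Choice of the parameters and final estimates *)

Lemma ln2_ge_half (R : realType) : 2^-1 <= ln 2 :> R.
Proof.
rewrite -[leLHS]expRK ler_ln ?posrE ?expR_gt0 ?ltr0n //.
have : expR 2^-1 - 1 <= 2^-1 / (1 - 2^-1) :> R by apply: expRB1_le; lra.
have -> : 1 - 2^-1 = 2^-1 :> R by lra.
by rewrite divff ?invr_neq0 ?pnatr_eq0 //; lra.
Qed.

(* Every load and every admissible [mu] is below [2 * sigma], so that
   [(expR eps - 1) * (2 * sigma)] bounds the relative growth of the potential
   in one phase. *)
Lemma eps_bounds (R : realType) (sigma delta : R) : 1 <= sigma ->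
  0 < delta <= 1 ->
  let eps := delta / (16 * sigma) in
  let eta := expR eps - 1 in
  [/\ 0 < eps, eta * (2 * sigma) < 1
    & eta <= (1 + delta / 2) * eps * (1 - eta * (2 * sigma))].
Proof.
move=> s1 /andP[d0 d1] /=.
set eps := delta / (16 * sigma).
have es : eps * sigma = delta / 16 by rewrite /eps; field; rewrite gt_eqF //; lra.
have e0 : 0 < eps by rewrite divr_gt0 //; lra.
have e1 : eps <= delta / 16 by rewrite -es ler_peMr // ltW.
have eta1 : expR eps - 1 <= eps * (1 + delta / 15).
  apply: le_trans (expRB1_le _) _; first lra.
  rewrite ler_wpM2l ?(ltW e0) // -div1r ler_pdivrMr; nra.
have h : (expR eps - 1) * (2 * sigma) <= 2 * delta / 15.
  have : (expR eps - 1) * (2 * sigma) <= eps * (1 + delta / 15) * (2 * sigma).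
    by rewrite ler_wpM2r //; lra.
  have -> : eps * (1 + delta / 15) * (2 * sigma)
      = (delta / 16) * (2 * (1 + delta / 15)) by rewrite -es; ring.
  nra.
split=> //; first lra.
apply: le_trans eta1 _; rewrite [_ * eps]mulrC -[leRHS]mulrA.
by rewrite ler_wpM2l ?(ltW e0) //; nra.
Qed.

(** Division of the logarithmic bound by [eps * tau]: the hypothesis on [L] turns the start-up term
    into [delta * c / 4], and that on [eta] absorbs the loss [1 / (1 - th)]. It serves with
    [G = sigma * avg] and with [G = mu]. *)
Lemma load_bound (R : realType) (eps tau x L eta G th delta c : R) :
  0 < eps -> 0 < tau -> 0 <= G -> th < 1 ->
  eta <= (1 + delta / 2) * eps * (1 - th) ->
  4 * L <= eps * delta * c * tau ->
  eps * tau * x <= L + eta * G * tau / (1 - th) ->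
  x <= delta * c / 4 + (1 + delta / 2) * G.
Proof.
move=> e0 t0 G0 th1 heta hL hx.
have d0 : 0 < 1 - th by lra.
have : eta * G * tau / (1 - th) <= (1 + delta / 2) * eps * G * tau.
  rewrite ler_pdivrMr // -mulrA [leRHS](_ : _ =
    (1 + delta / 2) * eps * (1 - th) * (G * tau)); last by ring.
  by rewrite ler_wpM2r // mulr_ge0 // ltW.
move=> h; rewrite -(ler_pM2l (mulr_gt0 e0 t0)); lra.
Qed.

(* K is the constant of the O-notation: it depends on sigma and c only.  The
   bound reads log (max m 2): it is log m for m >= 2, and m = 1 is the only
   other case, where log m = 0 cannot bound a number of calls. *)
Theorem theorem4 (R : realType) (sigma c : R) (hsigma : 1 <= sigma)
    (hc : 0 < c) :
  exists2 K : R, 0 < K &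
  forall (delta : R) (m : nat), 0 < delta <= 1 ->
  exists (eps : R) (T : nat), 0 < eps /\
  forall (C : finType) (cs : seq C) (X : C -> set 'rV[R]_m)
    (f : C -> 'rV[R]_m -> 'rV[R]_m),
  perm_eq cs (enum C) ->
  (forall i, [/\ X i !=set0, closed (X i), convex_set (X i)
               & forall x, X i x -> nneg x]) ->
  (forall i, is_oracle sigma (X i) (f i)) ->
  c <= lambda_star X <= 1 ->
  exists (y s : nat -> 'rV[R]_m) (k : nat -> nat),
    let x := primal_output T s in
    let z := dual_output T y in
    [/\ core_run f eps T cs y s k,
        minkowski_sum X x /\ simplex z,
        `|x| <= (1 + delta) * sigma * lambda_star X /\
        opt (minkowski_sum X) z >= (1 - delta) * (lambda_star X / sigma),
        forall (S : {set 'I_m}) (mu : R), 0 <= mu ->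
          local_weak_duality f S mu ->
          \big[Num.max/0]_(r in S) x 0 r
            <= mu + delta * Num.max (lambda_star X) mu
      & (\sum_(1 <= t < T.+1) k t)%:R
          <= K * ((#|C| + m)%:R / delta ^+ 2 * ln (maxn m 2)%:R)].
Proof.
have s0 : 0 < sigma by lra.
(* The factor [2 * sigma] bounds the calls of an average phase per customer and resource;
   [64 * sigma / c + 2] comes from the number of phases. *)
exists (2 * sigma * (64 * sigma / c + 2)).
  by rewrite mulr_gt0 ?addr_gt0 ?divr_gt0 //; lra.
move=> delta m hd; have /andP[d0 d1] := hd.
pose eps := delta / (16 * sigma); pose th := (expR eps - 1) * (2 * sigma).
pose lM : R := ln (maxn m 2)%:R.
(* [T] exceeds [q], so that [ln m / (eps * T)] is at most [delta * c / 4]. *)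
pose q := 4 * lM / (eps * delta * c); pose T := (Num.truncn q).+1.
have /= [] := eps_bounds hsigma hd; rewrite -/eps -/th => e0 th1 heta.
have lM0 : 2^-1 <= lM.
  apply: le_trans (ln2_ge_half R) _; rewrite ler_ln ?posrE ?ltr0n ?ler_nat ?leq_maxr //.
  by rewrite leq_max orbT.
have edc : 0 < eps * delta * c by apply: mulr_gt0 => //; apply: mulr_gt0.
have Tp : (0 < T)%N by [].
have T0 : 0 < T%:R :> R by rewrite ltr0n.
have hT : 4 * lM <= eps * delta * c * T%:R.
  by rewrite [leRHS]mulrC -ler_pdivrMr //; apply/ltW/truncnS_gt.
(* The additive 1 of the rounding is absorbed as [1 <= 2 * lM / delta ^+ 2], which uses
   [ln 2 >= 1 / 2]. *)
have Tle : T%:R <= (64 * sigma / c + 2) * (lM / delta ^+ 2).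
  have qT : (Num.truncn q)%:R <= q by rewrite truncn_le divr_ge0 ?(ltW edc) //; lra.
  have eq : q = 64 * sigma / c * (lM / delta ^+ 2).
    by rewrite /q /eps; field; rewrite !gt_eqF //; lra.
  have hq : 2^-1 <= lM / delta ^+ 2.
    by rewrite ler_pdivlMr ?exprn_gt0 //; nra.
  by rewrite -[T%:R]natr1 [leRHS]mulrDl -eq; lra.
exists eps, T; split=> // C cs X f pcs hX hf /andP[cl l1].
have X_neq0 i : X i !=set0 by have [] := hX i.
have X_convex i : convex_set (X i) by have [] := hX i.
have X_nneg i x : X i x -> nneg x by have [_ _ _] := hX i; apply.
(* Without resources all norms vanish, contradicting [0 < c <= lambda_star X]. *)
have m_gt0 : (0 < m)%N.
  rewrite lt0n; apply/eqP => m0; subst m.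
  have [x Xx] := minkowski_sum_neq0 X_neq0.
  have : `|x| <= 0 by apply/mx_normr_leP => // -[].
  by have := lambda_star_le Xx; lra.
have [y [s [k run]]] := core_run_total X_neq0 X_nneg hf e0 (ltW s0) T cs.
exists y, s, k => /=.
set x := primal_output T s; set z := dual_output T y.
set l := lambda_star X in cl l1 *.
have eta0 : 0 <= expR eps - 1 by rewrite expRB1_ge0 // ltW.
have hL : 4 * ln m%:R <= eps * delta * c * T%:R.
  apply: le_trans hT; rewrite ler_wpM2l //.
  by rewrite ler_ln ?posrE ?ltr0n ?ler_nat ?leq_maxl // leq_max m_gt0.
pose avg : R := T%:R^-1 * \sum_(1 <= t < T.+1) dual_value X y t.
have [avg0 avgl] : 0 <= avg /\ avg <= l.
  have hdv t : (t <= T)%N -> 0 <= dual_value X y t <= l.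
    exact: (dual_value_itv X_neq0 X_nneg m_gt0 run).
  split.
    rewrite mulr_ge0 ?invr_ge0 ?ler0n // big_add1 /= big_nat sumr_ge0 //.
    by move=> t /andP[_ /hdv/andP[]].
  rewrite /avg mulrC ler_pdivrMr // mulr_natr.
  have -> : l *+ T = \sum_(1 <= t < T.+1) l by rewrite sumr_const_nat subSS subn0.
  rewrite !big_add1 /= !big_nat; apply: ler_sum => t /andP[_ tT].
  by have /andP[] := hdv _ tT.
have xle r : x 0 r <= delta * c / 4 + (1 + delta / 2) * (sigma * avg).
  apply: (load_bound e0 T0 _ th1 heta hL); first by rewrite mulr_ge0 // ltW.
  have -> : (expR eps - 1) * (sigma * avg) * T%:R
      = (expR eps - 1) * sigma * \sum_(1 <= t < T.+1) dual_value X y t.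
    by rewrite /avg; field; rewrite gt_eqF.
  apply: (core_run_growth X_neq0 X_convex X_nneg hf e0 (ltW s0) Tp m_gt0 pcs run) => //.
  by rewrite /th -mulrA ler_wpM2l // -/l; nra.
have x0 : nneg x by apply: (primal_output_nneg X_convex X_nneg hf pcs run).
have Xx : minkowski_sum X x by apply: (primal_output_in X_convex hf Tp pcs run).
have sl : l <= sigma * l by nra.
have nx : `|x| <= (1 + delta) * sigma * l.
  apply/mx_normr_leP => [|r]; first by rewrite !mulr_ge0 //; lra.
  rewrite ger0_norm //; apply: le_trans (xle r) _.
  have : sigma * avg <= sigma * l by rewrite ler_wpM2l // ltW.
  nra.
split=> //.
- by split=> //; apply: (dual_output_in Tp m_gt0 run).
- split=> //.
  apply: le_trans (opt_dual_output X_neq0 X_nneg m_gt0 run); rewrite -/avg.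
  have lx : l <= delta * c / 4 + (1 + delta / 2) * (sigma * avg).
    apply: le_trans (lambda_star_le Xx) _.
    apply/mx_normr_leP => [|r]; last by rewrite ger0_norm.
    apply: addr_ge0; first by have := mulr_gt0 d0 hc; lra.
    by apply: mulr_ge0; [lra|rewrite mulr_ge0 // ltW].
  rewrite mulrA ler_pdivrMr // [avg * _]mulrC.
  (* With [c <= l], [lx] leaves at least [(1 - delta / 4) * l] for [(1 + delta / 2) * sigma * avg],
     and [(1 + delta / 2) * (1 - delta) <= 1 - delta / 4]. *)
  rewrite -(@ler_pM2l _ (1 + delta / 2)); last lra.
  nra.
- move=> S mu mu0 lwd; apply: bigmax_le => [|r rS].
    by rewrite addr_ge0 // mulr_ge0 // ?(ltW d0) // le_max mu0 orbT.
  have ml : l <= Num.max l mu by rewrite le_max lexx.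
  have mm : mu <= Num.max l mu by rewrite le_max lexx orbT.
  have [big|small] := leP ((1 + delta) * sigma * l) mu.
    apply: le_trans (ler_norm _) _; apply: le_trans (ler_mx_normr _ _) _.
    by apply: le_trans nx _; apply: le_trans big _; rewrite lerDl mulr_ge0 // ?(ltW d0) //; lra.
  (* Both [c] and [mu] are at most the maximum, and [1 / 4 + 1 / 2 <= 1]. *)
  apply: le_trans (_ : delta * c / 4 + (1 + delta / 2) * mu <= _); last by nra.
  apply: (load_bound e0 T0 mu0 th1 heta hL).
  apply: (core_run_local X_convex X_nneg hf e0 Tp m_gt0 pcs run mu0 lwd _ th1) => //.
  (* Here [mu < (1 + delta) * sigma * l <= 2 * sigma], as [th] demands. *)
  rewrite /th ler_wpM2l //; apply: le_trans (ltW small) _.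
  nra.
apply: le_trans (core_run_calls X_convex X_nneg hf e0 Tp pcs run) _; rewrite -/x.
have nx2 : `|x| <= 2 * sigma.
  by apply: le_trans nx _; nra.
have inner : #|C|%:R + m%:R * `|x| <= 2 * sigma * (#|C| + m)%:R.
  have := ler_wpM2l (ler0n R m) nx2; rewrite natrD.
  by have := ler0n R #|C|; nra.
apply: le_trans (ler_wpM2l (ltW T0) inner) _.
have P0 : 0 <= 2 * sigma * (#|C| + m)%:R by rewrite mulr_ge0 ?ler0n //; lra.
apply: le_trans (ler_wpM2r P0 Tle) _; rewrite -/lM.
by rewrite le_eqVlt; apply/orP; left; apply/eqP; ring.
Qed.
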